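(* Let $N\geq 3$ be an integer. For integers $r,s\geq 1$, $$c_{rs0}=\eta_{rs}.$$ For integers $r,s,t\geq 1$, $$c_{rst}\leq\gamma_N^2\,\eta_{rs}\eta_{rt}\eta_{st}\leq\gamma_N^3\,\eta_{rs}\eta_{rt}\eta_{st}.$$
   Context: Let $q\in(0,1)$ be determined by $N=q+q^{-1}$. Quantum integers: $[m]=\frac{q^{-m}-q^m}{q^{-1}-q}$, $[m]!=[m][m-1]\cdots[1]$, $[0]!=1$. Put $d_k=[k+1]$ for $k\ge0$ (equivalently $d_0=1$, $d_1=N$, $d_{k+1}=Nd_k-d_{k-1}$). For integers $r,s,t\ge0$ put $$\Theta_{rst}=\frac{[r+s+t+1]!\,[r]!\,[s]!\,[t]!}{[r+s]!\,[r+t]!\,[s+t]!},\qquad c_{rst}=\frac{\sqrt{d_{r+s}d_{r+t}d_{s+t}}}{\Theta_{rst}}.$$ For integers $r,s\ge1$ put $\eta_{rs}=\left(\frac{d_rd_s}{d_{r+s}}\right)^{1/2}$, and $\gamma_N=\left(1+\frac1{N^2}\right)^{1/2}$. *)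

(* Defs.v *)
From mathcomp Require Import all_boot all_order all_algebra.
From mathcomp Require Import reals.

Set Implicit Arguments.
Unset Strict Implicit.
Unset Printing Implicit Defensive.

Import Order.TTheory GRing.Theory Num.Theory.
Local Open Scope ring_scope.

Definition qint {R : realType} (q : R) (m : nat) : R :=
  (q ^- m - q ^+ m) / (q^-1 - q).

Definition qfact {R : realType} (q : R) (m : nat) : R :=
  \prod_(1 <= i < m.+1) qint q i.

Definition qdim {R : realType} (q : R) (k : nat) : R := qint q k.+1.

Definition Theta {R : realType} (q : R) (r s t : nat) : R :=
  (qfact q (r + s + t).+1 * qfact q r * qfact q s * qfact q t) /
  (qfact q (r + s) * qfact q (r + t) * qfact q (s + t)).

Definition c3 {R : realType} (q : R) (r s t : nat) : R :=
  Num.sqrt (qdim q (r + s) * qdim q (r + t) * qdim q (s + t)) /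
  Theta q r s t.

Definition eta2 {R : realType} (q : R) (r s : nat) : R :=
  Num.sqrt (qdim q r * qdim q s / qdim q (r + s)).

Definition gammaN (R : realType) (N : nat) : R :=
  Num.sqrt (1 + 1 / N%:R ^+ 2).

(* Main.v *)
(* Write x = q^2.  The ratio c_rst / (eta_rs eta_rt eta_st) equals
   [r+s+1]! [r+t+1]! [s+t+1]! / ([r+1]! [s+1]! [t+1]! [r+s+t+1]!).
   It is 1 at t = 0, and raising t by one multiplies it by
   [r+t+2] [s+t+2] / ([t+2] [r+s+t+2]) <= 1 / (1 - x^(t+2)).
   By the Weierstrass product inequality it is thus at most
   1 / (1 - (x^2 + ... + x^(t+1))).  For N >= 3 we have x <= 1/4,
   which makes this at most 1 + x / (1 + x)^2 = gamma_N^2. *)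
Require Import Defs.
From mathcomp Require Import all_boot all_order all_algebra.
From mathcomp Require Import reals.
From mathcomp Require Import ring lra.

Import Order.TTheory GRing.Theory Num.Theory.
Local Open Scope ring_scope.

Section QuantumIntegers.

Variables (R : realType) (q : R).
Hypotheses (q_gt0 : 0 < q) (q_lt1 : q < 1).

Lemma qint_gt0 m : (0 < m)%N -> 0 < qint q m.
Proof.
have invB_gt0 n : (0 < n)%N -> 0 < q ^- n - q ^+ n.
  move=> n_gt0; rewrite subr_gt0.
  have lt1 : q ^+ n < 1 by rewrite exprn_ilt1 ?ltW // -lt0n.
  by apply: (lt_trans lt1); rewrite invf_gt1 ?exprn_gt0.
(* The denominator [q^-1 - q] is the numerator at [m = 1]. *)
by move=> m_gt0; rewrite divr_gt0 ?invB_gt0 //; exact: (invB_gt0 1%N).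
Qed.

Lemma qint1 : qint q 1 = 1.
Proof.
have q1q : 0 < q^-1 - q.
  by rewrite subr_gt0 (lt_trans q_lt1) // invf_gt1.
by rewrite /qint !expr1 divff // gt_eqF.
Qed.

Lemma qfact0 : qfact q 0 = 1.
Proof. by rewrite /qfact big_geq. Qed.

Lemma qfactS m : qfact q m.+1 = qfact q m * qint q m.+1.
Proof. by rewrite /qfact big_nat_recr. Qed.

Lemma qfact_gt0 m : 0 < qfact q m.
Proof.
elim: m => [|m IHm]; first by rewrite qfact0.
by rewrite qfactS mulr_gt0 ?qint_gt0.
Qed.

Lemma qdim_gt0 k : 0 < qdim q k.
Proof. exact: qint_gt0. Qed.

Lemma Theta_gt0 r s t : 0 < Theta q r s t.
Proof. by rewrite divr_gt0 ?mulr_gt0 ?qfact_gt0. Qed.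

(** One step of the induction on [t], taken at [m = t + 2]. In [a = q ^+ r], [b = q ^+ s],
    [c = q ^+ m] the difference of the two sides is rational and factors into nonnegative terms. *)
Lemma qintM_le r s m : (0 < m)%N ->
  qint q (r + m) * qint q (s + m) * (1 - (q ^+ 2) ^+ m) <=
  qint q m * qint q (r + s + m).
Proof.
move=> m_gt0.
have q1q : 0 < q^-1 - q.
  by rewrite subr_gt0 (lt_trans q_lt1) // invf_gt1.
have qXV n : q ^- n - q ^+ n = (1 - (q ^+ n) ^+ 2) / q ^+ n.
  have : q ^+ n != 0 by rewrite gt_eqF ?exprn_gt0.
  by move: (q ^+ n) => y y0; field.
have [a0 b0 c0] : [/\ 0 < q ^+ r, 0 < q ^+ s & 0 < q ^+ m].
  by split; rewrite exprn_gt0.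
have [a1 b1 c1] : [/\ q ^+ r <= 1, q ^+ s <= 1 & q ^+ m <= 1].
  by split; rewrite exprn_ile1 ?ltW.
rewrite /qint !qXV (exprAC q 2 m) !(exprD q).
move: (q ^+ r) (q ^+ s) (q ^+ m) a0 b0 c0 a1 b1 c1 => a b c a0 b0 c0 a1 b1 c1.
have sqr01 z : 0 < z -> z <= 1 -> 0 <= z ^+ 2 <= 1.
  by move=> z0 z1; rewrite exprn_ge0 ?exprn_ile1 // ltW.
have [/andP[A0 A1] /andP[B0 B1] /andP[C0 C1]] :
  [/\ 0 <= a ^+ 2 <= 1, 0 <= b ^+ 2 <= 1 & 0 <= c ^+ 2 <= 1].
  by split; apply: sqr01.
rewrite -subr_ge0.
set D := q^-1 - q in q1q *.
have -> : (1 - c ^+ 2) / c / D * ((1 - (a * b * c) ^+ 2) / (a * b * c) / D) -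
   (1 - (a * c) ^+ 2) / (a * c) / D * ((1 - (b * c) ^+ 2) / (b * c) / D)
    * (1 - c ^+ 2) =
   (1 - c ^+ 2) * (a ^+ 2 * c ^+ 2 * (1 - b ^+ 2)
     + b ^+ 2 * c ^+ 2 * (1 - (a * c) ^+ 2)) / (a * b * c ^+ 2 * D ^+ 2).
  by field; rewrite !gt_eqF.
have acD : 0 <= 1 - (a * c) ^+ 2.
  by rewrite subr_ge0 exprMn mulr_ile1.
apply: divr_ge0; last by rewrite ltW // !mulr_gt0 ?exprn_gt0.
apply: mulr_ge0; first by rewrite subr_ge0.
by apply: addr_ge0; apply: mulr_ge0 => //; rewrite ?subr_ge0 //;
  apply: mulr_ge0.
Qed.

(** Induction on [t], kept in cross-multiplied form. The sum starts at 2 because the first step,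
    from [t = 0] to [t = 1], uses [m = 2]. *)
Lemma qfactM_le r s t : 0 <= 1 - \sum_(2 <= j < t.+2) (q ^+ 2) ^+ j ->
  qfact q (r + s).+1 * qfact q (r + t).+1 * qfact q (s + t).+1
    * (1 - \sum_(2 <= j < t.+2) (q ^+ 2) ^+ j) <=
  qfact q r.+1 * qfact q s.+1 * qfact q t.+1 * qfact q (r + s + t).+1.
Proof.
have x0 : 0 <= q ^+ 2 by rewrite exprn_ge0 ?ltW.
elim: t => [|t IHt] A_ge0.
  rewrite big_geq // subr0 mulr1 !addn0 !(qfactS 0) qfact0 qint1.
  by rewrite le_eqVlt; apply/orP; left; apply/eqP; ring.
have sum_ge0 : 0 <= \sum_(2 <= j < t.+2) (q ^+ 2) ^+ j.
  by apply: sumr_ge0 => j _; rewrite exprn_ge0.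
have xt0 : 0 <= (q ^+ 2) ^+ t.+2 by rewrite exprn_ge0.
have := qintM_le r s t.+2 isT.
move: A_ge0; rewrite big_nat_recr //= !addnS.
rewrite (qfactS (r + t).+1) (qfactS (s + t).+1) (qfactS t.+1)
  (qfactS (r + s + t).+1).
set S := \sum_(2 <= j < t.+2) _ in IHt sum_ge0 *.
set xt := (q ^+ 2) ^+ t.+2 in xt0 *.
move=> A_ge0 step.
(* The shorter sum is smaller, since [xt >= 0], so the sign condition passes down. *)
have {}IHt := IHt ltac:(lra).
have w1 : 0 <= qint q (r + t).+2 * qint q (s + t).+2.
  by rewrite mulr_ge0 // ltW // qint_gt0.
have P0 : 0 <= qfact q (r + s).+1 * qfact q (r + t).+1 * qfact q (s + t).+1.
  by rewrite !mulr_ge0 // ltW // qfact_gt0.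
have xt1 : xt <= 1 by lra.
set P := qfact q (r + s).+1 * _ * _ in IHt P0.
set Q := qfact q r.+1 * _ * _ * _ in IHt.
set W := _ * _ in w1; set V := _ * _ in step.
have -> : qfact q (r + s).+1 * (qfact q (r + t).+1 * qint q (r + t).+2)
   * (qfact q (s + t).+1 * qint q (s + t).+2) * (1 - (S + xt))
   = P * W * (1 - (S + xt)) by rewrite /P /W; ring.
have -> : qfact q r.+1 * qfact q s.+1 * (qfact q t.+1 * qint q t.+2)
   * (qfact q (r + s + t).+1 * qint q (r + s + t).+2)
   = Q * (qint q t.+2 * qint q (r + s + t).+2).
  by rewrite /Q; ring.
(* Weierstrass: [(1 - S) * (1 - xt)] exceeds [1 - (S + xt)] by [S * xt >= 0]. *)
apply: (@le_trans _ _ ((P * (1 - S)) * (W * (1 - xt)))).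
  rewrite -subr_ge0.
  have -> : P * (1 - S) * (W * (1 - xt)) - P * W * (1 - (S + xt)) =
    P * W * (S * xt) by ring.
  by rewrite mulr_ge0 // mulr_ge0.
by rewrite ler_pM // mulr_ge0 //; lra.
Qed.

Lemma sum_sqr_exp_le t : q ^+ 2 <= 1 / 4 ->
  1 <= (1 + q ^+ 2 / (1 + q ^+ 2) ^+ 2)
       * (1 - \sum_(2 <= j < t.+2) (q ^+ 2) ^+ j).
Proof.
set x := q ^+ 2 => x4.
have x0 : 0 <= x by rewrite exprn_ge0 ?ltW.
have geom n : (1 - x) * \sum_(2 <= j < n.+2) x ^+ j = x ^+ 2 * (1 - x ^+ n).
  elim: n => [|n IHn]; first by rewrite big_geq // expr0; ring.
  by rewrite big_nat_recr //= mulrDr IHn !exprS; ring.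
(* The geometric series is at most [x ^+ 2 / (1 - x)], and [x / (1 - x) <= 1 / 3] for
   [x <= 1 / 4]. *)
have S_le : \sum_(2 <= j < t.+2) x ^+ j <= x / 3.
  have xt0 : 0 <= x ^+ t by rewrite exprn_ge0.
  have : (1 - x) * \sum_(2 <= j < t.+2) x ^+ j <= x ^+ 2.
    by rewrite geom; have := exprn_ge0 2 x0; nra.
  by nra.
(* Here [16 / 25] is the value of [1 / (1 + x) ^+ 2] at [x = 1 / 4]. *)
have y_ge : x * (16 / 25) <= x / (1 + x) ^+ 2.
  have pos : 0 < (1 + x) ^+ 2 by rewrite exprn_gt0 // ltr_wpDr.
  have le1 : 16 / 25 * (1 + x) ^+ 2 <= 1 by nra.
  by rewrite ler_pdivlMr // -mulrA ler_piMr.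
set S := \sum_(2 <= j < _) _ in S_le *.
set y := x / (1 + x) ^+ 2 in y_ge *.
(* From [S <= x / 3 <= 1 / 12]; it remains that [16 / 25 * (11 / 12) >= 1 / 3]. *)
have : y * (11 / 12) <= y * (1 - S) by rewrite ler_wpM2l; lra.
lra.
Qed.

Lemma c3_r_s_0 r s : c3 q r s 0 = eta2 q r s.
Proof.
have dr := qdim_gt0 r; have ds := qdim_gt0 s; have d := qdim_gt0 (r + s).
(* At [t = 0] the factorials in [Theta] cancel down to [[r+s+1]]. *)
have -> : c3 q r s 0 = Num.sqrt (qdim q (r + s) * qdim q r * qdim q s)
                       / qdim q (r + s).
  rewrite /c3; congr (_ / _); first by rewrite !addn0.
  rewrite /Theta !addn0 qfactS qfact0 /qdim.
  by field; rewrite !gt_eqF ?qfact_gt0.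
rewrite /eta2 -{2}(gtr0_norm d) -sqrtr_sqr -sqrtrV ?sqr_ge0 //.
rewrite -sqrtrM; last by rewrite ltW // mulr_gt0 // mulr_gt0.
congr Num.sqrt.
by field; rewrite gt_eqF.
Qed.

(** Exposes the square root occurring in [c3], so that clearing denominators squares it away. *)
Lemma eta2_prod r s t :
  eta2 q r s * eta2 q r t * eta2 q s t = qdim q r * qdim q s * qdim q t
    / Num.sqrt (qdim q (r + s) * qdim q (r + t) * qdim q (s + t)).
Proof.
have [[dr ds] dt] := (qdim_gt0 r, qdim_gt0 s, qdim_gt0 t).
have [[drs drt] dst] :=
  (qdim_gt0 (r + s), qdim_gt0 (r + t), qdim_gt0 (s + t)).
have d0 : 0 < qdim q r * qdim q s * qdim q t by rewrite mulr_gt0 // mulr_gt0.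
rewrite /eta2 -!sqrtrM; first last.
- by rewrite ltW // divr_gt0 // mulr_gt0.
- by rewrite ltW // mulr_gt0 // divr_gt0 // mulr_gt0.
rewrite -(gtr0_norm d0) -sqrtr_sqr -sqrtrV;
  last by rewrite ltW // mulr_gt0 // mulr_gt0.
rewrite -sqrtrM ?sqr_ge0 //; congr Num.sqrt.
by field; rewrite !gt_eqF.
Qed.

(** Root-free form of the main bound, with [g] standing for the squared gamma. Since [[k]! [k+1] =
    [k+1]!], multiplying by the denominator of [Theta] reduces it to [qfactM_le]. *)
Lemma qdimM_le_Theta r s t (g : R) : 0 <= g ->
  0 <= 1 - \sum_(2 <= j < t.+2) (q ^+ 2) ^+ j ->
  1 <= g * (1 - \sum_(2 <= j < t.+2) (q ^+ 2) ^+ j) ->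
  qdim q (r + s) * qdim q (r + t) * qdim q (s + t) <=
  g * (qdim q r * qdim q s * qdim q t) * Theta q r s t.
Proof.
move=> g0 A0 gA; have := qfactM_le r s t A0.
set A := 1 - _ in gA *; move=> le_fact.
have P0 : 0 <= qfact q (r + s).+1 * qfact q (r + t).+1 * qfact q (s + t).+1.
  by rewrite !mulr_ge0 // ltW // qfact_gt0.
set P := _ * _ * _ in P0 le_fact; set Q := _ * _ * _ * _ in le_fact.
(* [P <= P * (g * A) = g * (P * A) <= g * Q]. *)
have le_PgQ : P <= g * Q by nra.
have F0 : 0 < qfact q (r + s) * qfact q (r + t) * qfact q (s + t).
  by rewrite !mulr_gt0 ?qfact_gt0.
have -> : g * (qdim q r * qdim q s * qdim q t) * Theta q r s t
   = g * Q / (qfact q (r + s) * qfact q (r + t) * qfact q (s + t)).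
  rewrite /Q /Theta (qfactS r) (qfactS s) (qfactS t) /qdim.
  by field; rewrite !gt_eqF ?qfact_gt0.
rewrite ler_pdivlMr //; apply: le_trans le_PgQ.
by rewrite /P !qfactS /qdim; rewrite le_eqVlt; apply/orP; left; apply/eqP; ring.
Qed.

End QuantumIntegers.

Theorem lemma3p1 (R : realType) (N : nat) (hN : (3 <= N)%N)
    (q : R) (hq0 : 0 < q) (hq1 : q < 1) (hq : N%:R = q + q^-1) :
  (forall r s : nat, (1 <= r)%N -> (1 <= s)%N ->
     c3 q r s 0 = eta2 q r s) /\
  (forall r s t : nat, (1 <= r)%N -> (1 <= s)%N -> (1 <= t)%N ->
     c3 q r s t <=
       gammaN R N ^+ 2 * (eta2 q r s * eta2 q r t * eta2 q s t) /\
     gammaN R N ^+ 2 * (eta2 q r s * eta2 q r t * eta2 q s t) <=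
       gammaN R N ^+ 3 * (eta2 q r s * eta2 q r t * eta2 q s t)).
Proof.
split=> [r s _ _|r s t _ _ _]; first exact: c3_r_s_0.
have N3 : 3 <= q + q^-1 by rewrite -hq (ler_nat R 3).
have qV : q * q^-1 = 1 by rewrite divff ?gt_eqF.
(* For [q] between [1 / 2] and 1, [q + q^-1] would stay below [5 / 2]. *)
have q_le : q <= 1 / 2 by nra.
have x4 : q ^+ 2 <= 1 / 4 by nra.
have N0 : 0 <= 1 / (N%:R : R) ^+ 2 by rewrite divr_ge0 ?sqr_ge0.
have gamma_ge1 : 1 <= gammaN R N.
  by rewrite /gammaN -[X in X <= _]sqrtr1 ler_wsqrtr // lerDl.
(* Uses [N = (1 + q ^+ 2) / q]. *)
have gamma2 : gammaN R N ^+ 2 = 1 + q ^+ 2 / (1 + q ^+ 2) ^+ 2.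
  rewrite /gammaN sqr_sqrtr ?addr_ge0 // hq; congr (1 + _).
  field.
  by rewrite !gt_eqF //; nra.
have gamma2_ge0 : 0 <= gammaN R N ^+ 2 by rewrite sqr_ge0.
have gA := sum_sqr_exp_le R q hq0 t x4; rewrite -gamma2 in gA.
(* A negative factor could not give a product of at least 1 with the nonnegative squared gamma. *)
have A0 : 0 <= 1 - \sum_(2 <= j < t.+2) (q ^+ 2) ^+ j by nra.
rewrite eta2_prod //.
have d0 k := qdim_gt0 R q hq0 hq1 k.
set D := qdim q (r + s) * qdim q (r + t) * qdim q (s + t).
have D0 : 0 < D by rewrite mulr_gt0 // mulr_gt0.
have sD0 : 0 < Num.sqrt D by rewrite sqrtr_gt0.
split; last first.
  apply: ler_wpM2r; last by rewrite exprS ler_peMl.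
  by rewrite divr_ge0 // ltW // mulr_gt0 // mulr_gt0.
rewrite /c3 -/D ler_pdivrMr ?Theta_gt0 // mulrA mulrAC ler_pdivlMr //.
rewrite -expr2 sqr_sqrtr; last exact: ltW.
exact: qdimM_le_Theta.
Qed.
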